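(* Let $\delta>0$, $\mathbb P$ a probability measure and $\phi$ as in the context. Then for $\Lambda\in\mathcal H_I$, $$\sup_{\mathbb Q\in\mathcal P_\phi(\mathbb P,\delta)}\Lambda\mathrm{VaR}^{\mathbb Q}=\Lambda\mathrm{VaR}^{g_{\phi,\delta}\circ\mathbb P},$$ and for $\alpha\in(0,1)$, $\sup_{\mathbb Q\in\mathcal P_\phi(\mathbb P,\delta)}\mathrm{VaR}^{\mathbb Q}_\alpha=\mathrm{VaR}_\alpha^{g_{\phi,\delta}\circ\mathbb P}$ (as functionals on $\mathcal X$). Moreover, if $\phi:[0,\infty)\to\mathbb R$ is strictly convex with $\lim_{x\to\infty}\phi(x)/x=\infty$, then $$\sup_{\mathbb Q\in\mathcal P_\phi(\mathbb P,\delta)}\Lambda\mathrm{VaR}^{\mathbb Q}=(g^{-1}_{\phi,\delta}\circ\Lambda)\mathrm{VaR}^{\mathbb P},\qquad \sup_{\mathbb Q\in\mathcal P_\phi(\mathbb P,\delta)}\mathrm{VaR}^{\mathbb Q}_\alpha=\mathrm{VaR}^{\mathbb P}_{g^{-1}_{\phi,\delta}(\alpha)},$$ and for every $X\in\mathcal X$, $$\lim_{\delta\downarrow0}\sup_{\mathbb Q\in\mathcal P_\phi(\mathbb P,\delta)}\Lambda\mathrm{VaR}^{\mathbb Q}(X)=\lim_{\delta\downarrow0}(g^{-1}_{\phi,\delta}\circ\Lambda)\mathrm{VaR}^{\mathbb P}(X)=\Lambda\mathrm{VaR}^{+,\mathbb P}(X).$$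
   Context: $(\Omega,\mathcal F)$ measurable space, $\mathcal X$ a set of real-valued random variables containing the bounded ones. For a capacity $w$ (monotone set function $\mathcal F\to[0,1]$ with $w(\emptyset)=0$, $w(\Omega)=1$; probability measures and $g\circ\mathbb P$ for increasing $g:[0,1]\to[0,1]$ with $g(0)=0,g(1)=1$ are capacities) and $\Lambda:\mathbb R\to[0,1]$: $\Lambda\mathrm{VaR}^w(X)=\inf\{x: w(X>x)\le\Lambda(x)\}$, $\Lambda\mathrm{VaR}^{+,w}(X)=\sup\{x: w(X>x)\ge\Lambda(x)\}$ ($\inf\emptyset=\infty$, $\sup\emptyset=-\infty$); $\mathrm{VaR}^w_\alpha$ is $\Lambda\mathrm{VaR}^w$ with $\Lambda\equiv\alpha$. $\mathcal H_I$: increasing functions $\mathbb R\to(0,1)$. $\phi:[0,\infty)\to\mathbb R\cup\{\infty\}$ convex with $\phi(1)=0$, $\phi(0)=\lim_{x\downarrow0}\phi(x)$; $D_\phi(\mathbb Q\|\mathbb P)=\mathbb E^{\mathbb P}[\phi(\mathrm d\mathbb Q/\mathrm d\mathbb P)]$ for $\mathbb Q\ll\mathbb P$; $\mathcal P_\phi(\mathbb P,\delta)=\{\mathbb Q\ll\mathbb P:D_\phi(\mathbb Q\|\mathbb P)\le\delta\}$. $g_{\phi,\delta}(0)=0$, $g_{\phi,\delta}(1)=1$, $g_{\phi,\delta}(x)=\sup\{t\in[x,1]: x\phi(t/x)+(1-x)\phi((1-t)/(1-x))\le\delta\}$ for $x\in(0,1)$. Under the strict convexity and superlinearity assumptions,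 $g_{\phi,\delta}$ is continuous and strictly increasing from $[0,x_\delta]$ onto $[0,1]$ and equals $1$ on $[x_\delta,1]$ for some $x_\delta\in(0,1)$; $g^{-1}_{\phi,\delta}:[0,1)\to[0,x_\delta)$ denotes the inverse of this restriction, so $g^{-1}_{\phi,\delta}\circ\Lambda$ is well defined for $\Lambda$ with values in $(0,1)$. *)

(* Defs.v *)
From mathcomp Require Import all_boot all_order all_algebra.
From mathcomp Require Import all_classical all_reals all_analysis.
Set Implicit Arguments.
Unset Strict Implicit.
Unset Printing Implicit Defensive.
Import Order.TTheory GRing.Theory Num.Theory.
Local Open Scope classical_set_scope.
Local Open Scope ring_scope.

Section LambdaVaR.
Context {d : measure_display} {T : measurableType d} {R : realType}.
Local Open Scope charge_scope.

Definition LVaR (w : set T -> \bar R) (L : R -> R) (X : T -> R) : \bar R :=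
  ereal_inf (EFin @` [set x : R | (w [set om | (x < X om)%R] <= (L x)%:E)%E]).

Definition LVaRp (w : set T -> \bar R) (L : R -> R) (X : T -> R) : \bar R :=
  ereal_sup (EFin @` [set x : R | ((L x)%:E <= w [set om | (x < X om)%R])%E]).

Definition VaR (w : set T -> \bar R) (alpha : R) (X : T -> R) : \bar R :=
  LVaR w (fun _ => alpha) X.

Definition distort (g : R -> R) (P : set T -> \bar R) : set T -> \bar R :=
  fun A => (g (fine (P A)))%:E.

Definition phi_div (phi : R -> \bar R) (P : probability T R)
    (Q : probability T R) : \bar R :=
  (\int[P]_x phi (fine (('d (charge_of_finite_measure Q) '/d P) x)))%E.

Definition Pphi (phi : R -> \bar R) (P : probability T R) (delta : R)
    : set (probability T R) :=
  [set Q : probability T R | Q `<< P /\ (phi_div phi P Q <= delta%:E)%E].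

End LambdaVaR.

Definition H_I {R : realType} (L : R -> R) : Prop :=
  {homo L : x y / x <= y} /\ (forall x, 0 < L x < 1).

(* phi : [0,oo) -> R \cup {+oo} convex, phi(1) = 0, phi(0) = lim_{x->0+} phi(x).
   phi is given as a function R -> \bar R; only its values on [0,oo) matter. *)
Definition admissible_phi {R : realType} (phi : R -> \bar R) : Prop :=
  [/\ (forall x : R, 0 <= x -> phi x != -oo%E),
      (forall x y t : R, 0 <= x -> 0 <= y -> 0 <= t <= 1 ->
         (phi (t * x + (1 - t) * y)%R <= t%:E * phi x + (1 - t)%:E * phi y)%E),
      phi 1 = 0%E &
      phi x @[x --> (0:R)^'+] --> phi 0].

Definition strict_superlinear_phi {R : realType} (phi : R -> \bar R) : Prop :=
  [/\ (forall x : R, 0 <= x -> phi x \is a fin_num),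
      (forall x y t : R, 0 <= x -> 0 <= y -> x != y -> 0 < t < 1 ->
         (phi (t * x + (1 - t) * y)%R < t%:E * phi x + (1 - t)%:E * phi y)%E) &
      (forall M : R, exists N : R, forall x, N < x -> M < fine (phi x) / x)].

(* g_{phi,delta} on [0,1] (values outside [0,1] are irrelevant) *)
Definition g_phi {R : realType} (phi : R -> \bar R) (delta : R) (x : R) : R :=
  if x <= 0 then 0 else if 1 <= x then 1 else
  sup [set t : R | x <= t <= 1 /\
        (x%:E * phi (t / x)%R + (1 - x)%:E * phi ((1 - t) / (1 - x))%R
           <= delta%:E)%E].

(* g^{-1}_{phi,delta} : [0,1) -> [0,x_delta), the inverse of the restriction
   of g_{phi,delta} to [0,x_delta]: for y in [0,1) the (unique) x in [0,1]
   with g_{phi,delta}(x) = y. *)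
Definition g_phi_inv {R : realType} (phi : R -> \bar R) (delta : R) (y : R) : R :=
  xget 0 [set x : R | 0 <= x <= 1 /\ g_phi phi delta x = y].

Definition rv_class {d : measure_display} {T : measurableType d} {R : realType}
    (XX : set (T -> R)) : Prop :=
  (forall X, XX X -> measurable_fun setT X) /\
  (forall X : T -> R, measurable_fun setT X -> (exists M : R, forall om, `|X om| <= M) ->
     XX X).

(* Main.v *)
Require Import Defs.
From HB Require Import structures.
From mathcomp Require Import all_boot all_order all_algebra.
From mathcomp Require Import all_classical all_reals all_analysis.
From mathcomp Require Import measurable_realfun ring lra.
Set Implicit Arguments.
Unset Strict Implicit.
Unset Printing Implicit Defensive.
Import Order.TTheory GRing.Theory Num.Theory.
Local Open Scope classical_set_scope.
Local Open Scope ring_scope.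

(** Everything follows from [sup {Q A | Q in Pphi} = g_phi (P A)] for each event
    [A].  The upper bound is Jensen's inequality on [A] and on its complement,
    in the form of two supporting lines of [phi]; the lower bound uses the [Q]
    whose density is constant on [A] and on its complement.  As [L] is
    increasing and tails are decreasing, one [Q] with [Q (X > x) > L x] already
    gives [x <= LVaR Q L X], so the supremum passes through [LVaR].

    When [phi] is finite, [x phi(t/x) + (1-x) phi((1-t)/(1-x))] is jointly convex
    in [(x, t)] and vanishes on the diagonal.  Convexity makes [g_phi] strictly
    increasing below the level 1, superlinearity makes it reach every level in
    (0, 1), and strict convexity makes it tend to the identity as [delta]
    decreases to 0, while [p < g_phi p] for each positive [delta]. *)

(** * Supporting lines of an extended-real convex function *)

Section convex_extended.
Context {R : realType}.
Variable phi : R -> \bar R.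
Hypothesis hphi : admissible_phi phi.

Lemma phi_fin_ltoo (y : R) : 0 <= y -> (phi y < +oo)%E -> phi y \is a fin_num.
Proof. by case: hphi => pN _ _ _ y0 yoo; rewrite fin_numE pN//= lt_eqF. Qed.

Lemma phi1_fin : phi 1 \is a fin_num.
Proof. by case: hphi => _ _ -> _. Qed.

Lemma phi_fin_convex (x y t : R) : 0 <= x -> 0 <= y -> 0 <= t <= 1 ->
  phi x \is a fin_num -> phi y \is a fin_num ->
  phi (t * x + (1 - t) * y) \is a fin_num /\
  fine (phi (t * x + (1 - t) * y)) <= t * fine (phi x) + (1 - t) * fine (phi y).
Proof.
move=> x0 y0 t01 xf yf; have [_ cvx _ _] := hphi.
have := cvx x y t x0 y0 t01.
rewrite -(fineK xf) -(fineK yf) -!EFinM -EFinD => le.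
have zf : phi (t * x + (1 - t) * y) \is a fin_num.
  apply: phi_fin_ltoo; first by case/andP: t01 => ? ?; nra.
  by apply: (le_lt_trans le); rewrite ltry.
split=> //; rewrite -lee_fin (fineK zf). exact: le.
Qed.

Lemma phi_three_points (x m y : R) : 0 <= x -> x < m -> m < y ->
  phi x \is a fin_num -> phi y \is a fin_num ->
  phi m \is a fin_num /\
  (y - x) * fine (phi m) <= (y - m) * fine (phi x) + (m - x) * fine (phi y).
Proof.
move=> x0 xm my xf yf.
have yx : 0 < y - x by lra.
have t01 : 0 <= (y - m) / (y - x) <= 1.
  by rewrite divr_ge0 ?ler_pdivrMr//=; lra.
have y0 : 0 <= y by lra.
have [] := phi_fin_convex x0 y0 t01 xf yf.
have -> : (y - m) / (y - x) * x + (1 - (y - m) / (y - x)) * y = m.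
  by field; rewrite gt_eqF.
move=> mf le; split=> //.
have : (y - x) * fine (phi m) <= (y - x) * ((y - m) / (y - x) * fine (phi x) +
    (1 - (y - m) / (y - x)) * fine (phi y)) by rewrite ler_pM2l.
suff -> : (y - x) * ((y - m) / (y - x) * fine (phi x) +
    (1 - (y - m) / (y - x)) * fine (phi y)) =
    (y - m) * fine (phi x) + (m - x) * fine (phi y) by [].
by field; rewrite gt_eqF.
Qed.

(** The slope [s] is the supremum of the slopes of chords ending at [m] from the left. The finite
    point [v] makes this set nonempty. By the three-point inequality every chord leaving [m] to the
    right has a larger slope, and the one to [u] bounds the set. *)
Lemma phi_support (v m u : R) : 0 <= v -> v < m -> m < u ->
  phi v \is a fin_num -> phi u \is a fin_num ->
  phi m \is a fin_num /\
  exists s : R, forall y, 0 <= y ->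
    ((fine (phi m) + s * (y - m))%:E <= phi y)%E.
Proof.
move=> v0 vm mu vf uf.
have [mf _] := phi_three_points v0 vm mu vf uf; split=> //.
pose slope x := (fine (phi m) - fine (phi x)) / (m - x).
have slope_le x y : 0 <= x -> x < m -> m < y -> phi x \is a fin_num ->
    phi y \is a fin_num -> slope x <= (fine (phi y) - fine (phi m)) / (y - m).
  move=> x0 xm my xf yf; have [_ h] := phi_three_points x0 xm my xf yf.
  rewrite /slope ler_pdivrMr ?subr_gt0// mulrAC ler_pdivlMr ?subr_gt0//.
  by lra.
pose S := [set slope x | x in [set x | [/\ 0 <= x, x < m & phi x \is a fin_num]]].
have Sub y : m < y -> phi y \is a fin_num ->
    ubound S ((fine (phi y) - fine (phi m)) / (y - m)).
  by move=> my yf _ [x [x0 xm xf] <-]; exact: slope_le.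
have S0 : S !=set0 by exists (slope v), v.
exists (sup S) => y y0.
have [yf|] := boolP (phi y \is a fin_num); last first.
  case: hphi => /(_ _ y0) + _ _ _.
  by case: (phi y) => //= _ _; exact: leey.
rewrite -[leRHS]fineK// lee_fin.
have [ym|my|->] := ltgtP y m; last by rewrite subrr; lra.
- have : slope y <= sup S.
    apply: ub_le_sup; first by exists ((fine (phi u) - fine (phi m)) / (u - m)); exact: Sub.
    by exists y.
  by rewrite /slope ler_pdivrMr ?subr_gt0//; lra.
- have : sup S <= (fine (phi y) - fine (phi m)) / (y - m).
    by apply: ge_sup => //; exact: Sub.
  by rewrite ler_pdivlMr ?subr_gt0//; lra.
Qed.

(** If [phi] is finite somewhere besides 1, the midpoint of the two points has a supporting line.
    Otherwise [phi] is infinite off 1, and the zero function is a minorant. *)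
Lemma phi_affine_lower_bound : exists a b : R, forall y, 0 <= y ->
  ((a + b * y)%:E <= phi y)%E.
Proof.
have [_ _ p1 _] := hphi.
have aux v u : 0 <= v -> v < u -> phi v \is a fin_num -> phi u \is a fin_num ->
    exists a b : R, forall y, 0 <= y -> ((a + b * y)%:E <= phi y)%E.
  move=> v0 vu vf uf.
  have [] := @phi_support v ((v + u) / 2) u v0 _ _ vf uf; [lra|lra|].
  move=> mf [s hs].
  exists (fine (phi ((v + u) / 2)) - s * ((v + u) / 2)), s => y y0.
  by apply: le_trans (hs _ y0); rewrite lee_fin; lra.
have [[u [u0 u1 uf]]|h] :=
    pselect (exists u, [/\ 0 <= u, u != 1 & phi u \is a fin_num]).
  have [lt1|gt1|/eqP] := ltgtP u 1; last by rewrite (negbTE u1).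
  - exact: (aux u 1 u0 lt1 uf phi1_fin).
  - exact: (aux 1 u ler01 gt1 phi1_fin uf).
exists 0, 0 => y y0; rewrite mul0r addr0.
have [->|y1] := eqVneq y 1; first by rewrite p1.
rewrite leNgt; apply/negP => ylt0; apply: h; exists y; split=> //.
by apply: phi_fin_ltoo => //; apply: lt_trans ylt0 (ltry 0).
Qed.

End convex_extended.

(** * The supremum defining [g_phi] *)

Section g_phi_sup.
Context {R : realType}.
Variables (phi : R -> \bar R) (delta : R).
Hypothesis hphi : admissible_phi phi.
Hypothesis delta_gt0 : 0 < delta.

Let E x t := (x%:E * phi (t / x)%R + (1 - x)%:E * phi ((1 - t) / (1 - x))%R
           <= delta%:E)%E.

Lemma g_phi0 (x : R) : x <= 0 -> g_phi phi delta x = 0.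
Proof. by rewrite /g_phi => ->. Qed.

Lemma g_phi1 : g_phi phi delta 1 = 1.
Proof. by rewrite /g_phi ler10 lexx. Qed.

Let gE x : 0 < x < 1 -> g_phi phi delta x = sup [set t | x <= t <= 1 /\ E x t].
Proof. by case/andP=> x0 x1; rewrite /g_phi !leNgt x0 x1. Qed.

Let Sx x : 0 < x < 1 -> [set t | x <= t <= 1 /\ E x t] x.
Proof.
case/andP=> x0 x1; split; first lra; rewrite /E !divff ?gt_eqF//; last lra.
by case: hphi => _ _ -> _; rewrite !mule0 adde0 lee_fin ltW.
Qed.

Lemma g_phi_ub (x t : R) : 0 < x < 1 -> x <= t <= 1 -> E x t -> t <= g_phi phi delta x.
Proof.
move=> x01 xt Ext; rewrite gE//; apply: ub_le_sup; last by split.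
by exists 1 => u /= [/andP[]].
Qed.

Lemma g_phi_ge (x : R) : 0 < x < 1 -> x <= g_phi phi delta x.
Proof. by move=> x01; have [? ?] := Sx x01; exact: g_phi_ub. Qed.

Lemma g_phi_least (x c : R) : 0 < x < 1 ->
  (forall t, x <= t <= 1 -> E x t -> t <= c) -> g_phi phi delta x <= c.
Proof.
move=> x01 h; rewrite gE//; apply: ge_sup; first by exists x; exact: Sx.
by move=> t [xt]; exact: h.
Qed.

Lemma g_phi_approx (x c : R) : 0 < x < 1 -> c < g_phi phi delta x ->
  exists t, [/\ x <= t <= 1, E x t & c < t].
Proof.
move=> x01 cg; apply: contrapT => h; move: cg; rewrite ltNge => /negP; apply.
apply: g_phi_least => // t xt Et; rewrite leNgt; apply/negP => ct.
by apply: h; exists t.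
Qed.

End g_phi_sup.

(** * Joint convexity of the divergence between two-point laws *)

Section convex_real.
Context {R : realType}.
Variable f : R -> R.
Hypothesis f_convex : forall x y t, 0 <= x -> 0 <= y -> 0 <= t <= 1 ->
  f (t * x + (1 - t) * y) <= t * f x + (1 - t) * f y.
Hypothesis f1 : f 1 = 0.

(** The divergence of the Bernoulli law with parameter [t] from the one with parameter [x]. *)
Definition binary_div (f : R -> R) x t :=
  x * f (t / x) + (1 - x) * f ((1 - t) / (1 - x)).

Lemma binary_div_diag (x : R) : 0 < x < 1 -> binary_div f x x = 0.
Proof.
by move=> x01; rewrite /binary_div !divff ?gt_eqF ?f1 ?mulr0 ?addr0//; lra.
Qed.

(** The perspective of a convex function is jointly convex: apply convexity at [t1 / x1] and
    [t2 / x2] with weight [l * x1 / X], then multiply by [X]. *)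
Lemma perspective_convex (x1 t1 x2 t2 l : R) :
  0 < x1 -> 0 < x2 -> 0 <= t1 -> 0 <= t2 -> 0 <= l <= 1 ->
  (l * x1 + (1 - l) * x2) *
    f ((l * t1 + (1 - l) * t2) / (l * x1 + (1 - l) * x2)) <=
  l * (x1 * f (t1 / x1)) + (1 - l) * (x2 * f (t2 / x2)).
Proof.
move=> x10 x20 t10 t20 /andP[l0 l1].
set X := l * x1 + (1 - l) * x2.
have X0 : 0 < X.
  rewrite /X; have [->|ln0] := eqVneq l 0; first lra.
  have : 0 < l * x1 by rewrite mulr_gt0// lt0r ln0.
  have : 0 <= (1 - l) * x2 by rewrite mulr_ge0 ?subr_ge0// ltW.
  by lra.
have t01 : 0 <= l * x1 / X <= 1.
  rewrite divr_ge0 ?mulr_ge0//; [|exact: ltW..].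
  rewrite ler_pdivrMr//= mul1r /X lerDl mulr_ge0 ?subr_ge0//; exact: ltW.
have := f_convex (divr_ge0 t10 (ltW x10)) (divr_ge0 t20 (ltW x20)) t01.
rewrite -(ler_pM2l X0).
have -> : l * x1 / X * (t1 / x1) + (1 - l * x1 / X) * (t2 / x2) =
    (l * t1 + (1 - l) * t2) / X.
  by rewrite /X; field; rewrite !gt_eqF.
move=> /le_trans; apply.
suff -> : X * (l * x1 / X * f (t1 / x1) + (1 - l * x1 / X) * f (t2 / x2)) =
  l * (x1 * f (t1 / x1)) + (1 - l) * (x2 * f (t2 / x2)) by [].
by rewrite /X; field; rewrite !gt_eqF.
Qed.

Lemma binary_div_convex (x1 t1 x2 t2 l : R) :
  0 < x1 < 1 -> 0 < x2 < 1 -> 0 <= t1 <= 1 -> 0 <= t2 <= 1 -> 0 <= l <= 1 ->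
  binary_div f (l * x1 + (1 - l) * x2) (l * t1 + (1 - l) * t2) <=
  l * binary_div f x1 t1 + (1 - l) * binary_div f x2 t2.
Proof.
move=> /andP[x10 x11] /andP[x20 x21] /andP[t10 t11] /andP[t20 t21] l01.
have h1 := perspective_convex x10 x20 t10 t20 l01.
have := @perspective_convex (1 - x1) (1 - t1) (1 - x2) (1 - t2) l.
rewrite !subr_gt0 !subr_ge0 => /(_ x11 x21 t11 t21 l01).
have -> : l * (1 - x1) + (1 - l) * (1 - x2) = 1 - (l * x1 + (1 - l) * x2) by ring.
have -> : l * (1 - t1) + (1 - l) * (1 - t2) = 1 - (l * t1 + (1 - l) * t2) by ring.
by rewrite /binary_div; move: h1; lra.
Qed.

(* Convexity in [x] stands in for the continuity of [binary_div f ^~ y]. *)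
Lemma binary_div_ivt (y x0 delta : R) : 0 < y < 1 -> 0 < delta ->
  0 < x0 -> x0 < y -> (forall x, 0 < x -> x <= x0 -> delta < binary_div f x y) ->
  exists x, 0 < x < y /\ binary_div f x y = delta.
Proof.
move=> y01 d0 x00 x0y Fbig; have [y0 y1] := andP y01.
pose F x := binary_div f x y.
have Fc x1 x2 l : 0 < x1 < 1 -> 0 < x2 < 1 -> 0 <= l <= 1 ->
    F (l * x1 + (1 - l) * x2) <= l * F x1 + (1 - l) * F x2.
  move=> h1 h2 hl; have y01' : 0 <= y <= 1 by lra.
  have := binary_div_convex h1 h2 y01' y01' hl.
  by rewrite (_ : l * y + (1 - l) * y = y)//; ring.
have Fy : F y = 0 by exact: binary_div_diag.
pose S := [set x | 0 < x <= y /\ F x <= delta].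
have Sy : S y by split; [lra|rewrite Fy ltW].
have Slb : lbound S x0.
  move=> x [/andP[x_gt0 _] Fx]; rewrite leNgt; apply/negP => xx0.
  by have := Fbig _ x_gt0 (ltW xx0); rewrite ltNge Fx.
have hinf : has_inf S by split; [exists y|exists x0].
pose c := inf S.
have cx0 : x0 <= c by apply: lb_le_inf => //; exists y.
have cy : c <= y by apply: ge_inf => //; exists x0.
exists c; rewrite -/(F c).
have Fx0 : delta < F x0 by apply: Fbig => //; exact: lexx.
suff Fcd : F c = delta.
  split=> //; apply/andP; split; first lra.
  by rewrite lt_neqAle cy andbT; apply/eqP => cyE; move: Fcd; rewrite cyE Fy; lra.
apply/eqP; rewrite eq_le; apply/andP; split; rewrite leNgt; apply/negP => Fcd.
(* Suppose [F c > delta]. On the chord from [a] to a point [x] of [S], the value at [c] forces [x]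
   to be at least [c + k], contradicting the choice of [c]. Halving [x0] keeps [a < c] even when
   [c = x0]. *)
- have Fa : delta < F (x0 / 2) by apply: Fbig; lra.
  pose a := x0 / 2; have ac : a < c by rewrite /a; lra.
  pose k := (F c - delta) * (c - a) / (F a - delta).
  have k0 : 0 < k by rewrite /k divr_gt0 ?mulr_gt0 ?subr_gt0.
  suff : c + k <= inf S by rewrite -/c; lra.
  apply: lb_le_inf; first by exists y.
  move=> x [/andP[x_gt0 xy] Fx].
  have cx : c <= x by apply: ge_inf; [exists x0|split=> //; lra].
  have xa : 0 < x - a by lra.
  have l01 : 0 <= (x - c) / (x - a) <= 1.
    by rewrite divr_ge0 ?ler_pdivrMr//=; lra.
  have a01 : 0 < a < 1 by rewrite /a; lra.
  have x01 : 0 < x < 1 by lra.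
  have := Fc _ _ _ a01 x01 l01.
  have -> : (x - c) / (x - a) * a + (1 - (x - c) / (x - a)) * x = c.
    by field; rewrite gt_eqF.
  set l := (x - c) / (x - a) => le.
  have : F c - delta <= l * (F a - delta).
    have : (1 - l) * F x <= (1 - l) * delta.
      by apply: ler_wpM2l => //; move: l01; rewrite -/l; lra.
    by move: le; lra.
  rewrite -ler_pdivrMr ?subr_gt0// => hl.
  have : (F c - delta) / (F a - delta) * (c - a) <= (x - c).
    have : l * (c - a) <= x - c.
      rewrite /l mulrAC ler_pdivrMr// ler_wpM2l//; lra.
    apply: le_trans; rewrite ler_wpM2r//; lra.
  by rewrite /k mulrAC; lra.
(* Suppose [F c < delta]. The chord from [x0] to [c] takes the value [delta] at some [x' < c], so
   [x'] lies in [S] below its infimum. *)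
- have cx0' : x0 < c.
    by rewrite lt_neqAle cx0 andbT; apply/eqP => E; move: Fcd Fx0; rewrite -E; lra.
  have Fcx : 0 < F x0 - F c by lra.
  pose l := (delta - F c) / (F x0 - F c).
  have l0 : 0 < l by rewrite divr_gt0//; lra.
  have l1 : l < 1 by rewrite /l ltr_pdivrMr//; lra.
  have x001 : 0 < x0 < 1 by lra.
  have c01 : 0 < c < 1 by lra.
  have l01 : 0 <= l <= 1 by lra.
  have := Fc x0 c l x001 c01 l01.
  have -> : l * F x0 + (1 - l) * F c = delta.
    by rewrite /l; field; rewrite gt_eqF.
  set x' := l * x0 + (1 - l) * c => Fx'.
  have x'c : x' < c.
    have : 0 < l * (c - x0) by rewrite mulr_gt0// subr_gt0.
    by rewrite /x'; lra.
  have : inf S <= x'.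
    apply: ge_inf; first by exists x0.
    split=> //; apply/andP; split; last lra.
    have : 0 < l * x0 by rewrite mulr_gt0.
    have : 0 < (1 - l) * c by rewrite mulr_gt0//; lra.
    by rewrite /x'; lra.
  by rewrite leNgt x'c.
Qed.

End convex_real.

(** * Monotonicity, range and small-[delta] behaviour of [g_phi] for finite [phi] *)

Section g_phi_finite.
Context {R : realType}.
Variable phi : R -> \bar R.
Hypothesis hphi : admissible_phi phi.
Hypothesis hsup : strict_superlinear_phi phi.

Let f y := fine (phi y).

Let phi_fin (y : R) : 0 <= y -> phi y \is a fin_num.
Proof. by case: hsup => + _ _; exact. Qed.

Let f_convex (x y t : R) : 0 <= x -> 0 <= y -> 0 <= t <= 1 ->
  f (t * x + (1 - t) * y) <= t * f x + (1 - t) * f y.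
Proof.
move=> x0 y0 t01.
by have [] := phi_fin_convex hphi x0 y0 t01 (phi_fin x0) (phi_fin y0).
Qed.

Let f1 : f 1 = 0.
Proof. by rewrite /f; case: hphi => _ _ -> _. Qed.

Let phi_divE (x t : R) : 0 < x < 1 -> 0 <= t <= 1 ->
  (x%:E * phi (t / x)%R + (1 - x)%:E * phi ((1 - t) / (1 - x))%R =
   (binary_div f x t)%:E)%E.
Proof.
move=> /andP[x0 x1] /andP[t0 t1].
rewrite -(@fineK _ (phi (t / x))) ?phi_fin ?divr_ge0 ?(ltW x0)//.
by rewrite -(@fineK _ (phi (_ / (1 - x)))) ?phi_fin ?divr_ge0 ?subr_ge0 ?(ltW x1).
Qed.

Let div_conv := binary_div_convex f_convex.
Let div_diag := binary_div_diag f1.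

Section fixed_delta.
Variable delta : R.
Hypothesis delta_gt0 : 0 < delta.
Let g := g_phi phi delta.

Let g_ub (x t : R) : 0 < x < 1 -> x <= t <= 1 -> binary_div f x t <= delta -> t <= g x.
Proof.
move=> x01 xt le; apply: g_phi_ub => //.
by rewrite phi_divE ?lee_fin//; lra.
Qed.

Let g_least (x c : R) : 0 < x < 1 ->
  (forall t, x <= t <= 1 -> binary_div f x t <= delta -> t <= c) -> g x <= c.
Proof.
move=> x01 h; apply: g_phi_least => // t xt.
by rewrite phi_divE ?lee_fin//; [exact: h|lra].
Qed.

Let g_approx (x c : R) : 0 < x < 1 -> c < g x ->
  exists t, [/\ x <= t <= 1, binary_div f x t <= delta & c < t].
Proof.
move=> x01 cg; have [t [xt + ct]] := g_phi_approx hphi delta_gt0 x01 cg.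
by rewrite phi_divE ?lee_fin//; [exists t|lra].
Qed.

(* Move from a point [(x, t)] of the convex region [binary_div f <= delta]
   towards a point [(z, z)] of its diagonal with [z] close to 1. *)
Lemma g_phi_lt (x p c : R) : 0 < x -> x < p -> p < 1 -> c < 1 ->
  c <= g_phi phi delta x -> c < g_phi phi delta p.
Proof.
move=> x0 xp p1 c1 cg.
have x01 : 0 < x < 1 by lra.
have p01 : 0 < p < 1 by lra.
have [z [pz cz z1]] : exists z, [/\ p < z, c < z & z < 1].
  by have [pc|cp] := leP p c; [exists ((c + 1) / 2)|exists ((p + 1) / 2)]; split; lra.
have zx : 0 < z - x by lra.
pose l := (z - p) / (z - x).
have l0 : 0 < l by rewrite divr_gt0// subr_gt0.
have l1 : l < 1 by rewrite /l ltr_pdivrMr//; lra.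
(* This is the value of [t] for which [l * t + (1 - l) * z] equals [c]. It lies strictly below [c]
   since [z > c], so [c <= g x] leaves room for an admissible [t] above it. *)
have hlt : (c - (1 - l) * z) / l < c.
  rewrite ltr_pdivrMr// -subr_gt0 (_ : _ - _ = (1 - l) * (z - c)); last by ring.
  by rewrite mulr_gt0 ?subr_gt0.
have [t [xt Ft]] := g_approx x01 (lt_le_trans hlt cg).
rewrite ltr_pdivrMr// => ct.
have t'c : c < l * t + (1 - l) * z by lra.
apply: (lt_le_trans t'c).
have pE : l * x + (1 - l) * z = p by rewrite /l; field; rewrite gt_eqF.
apply: g_ub => //.
  apply/andP; split.
    rewrite -pE lerD2r ler_pM2l//; lra.
  have : l * t <= l * 1 by rewrite ler_pM2l//; lra.
  have : (1 - l) * z <= (1 - l) * 1 by rewrite ler_pM2l ?subr_gt0//; lra.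
  by lra.
rewrite -[in X in binary_div f X]pE.
have z01 : 0 < z < 1 by lra.
apply: (@le_trans _ _ (l * binary_div f x t + (1 - l) * binary_div f z z)).
  by apply: div_conv => //; lra.
rewrite div_diag// mulr0 addr0.
have : l * binary_div f x t <= l * delta by rewrite ler_pM2l.
have : l * delta <= 1 * delta by rewrite ler_pM2r// ltW.
by lra.
Qed.

(** Going a fraction [e] of the way from [(p, p)] to [(p, 1)] costs at most [e * D] by convexity,
    which is at most [delta] for small [e]. *)
Lemma g_phi_gt_id (p : R) : 0 < p < 1 -> p < g_phi phi delta p.
Proof.
move=> p01; have [p0 p1] := andP p01; have d0 : 0 < delta := delta_gt0.
have [D [D0 FD]] : exists D : R, 0 <= D /\ binary_div f p 1 <= D.
  by exists `|binary_div f p 1|; rewrite normr_ge0 ler_norm.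
pose e := delta / (delta + D).
have dD : 0 < delta + D by lra.
have e0 : 0 < e by rewrite divr_gt0.
have e1 : e <= 1 by rewrite /e ler_pdivrMr//; lra.
have eD : e * D <= delta.
  rewrite /e mulrAC ler_pdivrMr//.
  by rewrite ler_pM2l//; lra.
have pt : p < (1 - e) * p + e * 1.
  have : 0 < e * (1 - p) by rewrite mulr_gt0 ?subr_gt0.
  by lra.
apply: (lt_le_trans pt); apply: g_ub => //.
  rewrite ltW//=.
  have : (1 - e) * p <= (1 - e) * 1 by rewrite ler_wpM2l ?subr_ge0// ltW.
  by lra.
have pE : e * p + (1 - e) * p = p by ring.
rewrite addrC -[in X in binary_div f X]pE.
apply: (@le_trans _ _ (e * binary_div f p 1 + (1 - e) * binary_div f p p)).
  by apply: div_conv => //; lra.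
rewrite div_diag// mulr0 addr0.
by apply: le_trans eD; rewrite ler_pM2l.
Qed.

(** For [x] near 0 superlinearity pushes [binary_div f x y] above [delta], so some [x < y] gives
    exactly [delta]. For this [x], convexity in [t] along the segment from the zero at [t = x]
    excludes every [t > y]. *)
Lemma g_phi_onto (y : R) : 0 < y < 1 -> exists x, 0 < x < 1 /\ g_phi phi delta x = y.
Proof.
move=> y01; have [y0 y1] := andP y01.
have [a [b ab]] := phi_affine_lower_bound hphi.
(* The surplus over [delta] absorbs the second term of [binary_div], which the affine minorant
   bounds below by [- |a| - |b|]. *)
have [_ _ /(_ ((delta + `|a| + `|b|) / y))[N hN]] := hsup.
pose n := `|N| + 2.
have n2 : 2 <= n by rewrite /n lerDr.
have Nn : N < n by have := ler_norm N; rewrite /n; lra.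
have n0 : 0 < n by lra.
have xn0 : 0 < y / n by rewrite divr_gt0.
have xny : y / n < y by rewrite ltr_pdivrMr// -[ltLHS]mulr1 ltr_pM2l//; lra.
have big (x : R) : 0 < x -> x <= y / n -> delta < binary_div f x y.
  move=> x0 xn; have xy : x < y by lra.
  have Nyx : N < y / x.
    apply: (lt_le_trans Nn); rewrite ler_pdivlMr// mulrC.
    by move: xn; rewrite ler_pdivlMr.
  have h1 : delta + `|a| + `|b| < x * f (y / x).
    have := hN _ Nyx; rewrite -/(f _).
    rewrite ltr_pdivrMr// => /lt_le_trans; apply.
    suff -> : f (y / x) / (y / x) * y = x * f (y / x) by [].
    by field; rewrite !gt_eqF.
  have x1 : 0 < 1 - x by lra.
  have q0 : 0 <= (1 - y) / (1 - x) by rewrite divr_ge0//; lra.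
  have h2 : a * (1 - x) + b * (1 - y) <= (1 - x) * f ((1 - y) / (1 - x)).
    have := ab _ q0; rewrite -[leRHS]fineK ?phi_fin// lee_fin -/(f _).
    rewrite -(ler_pM2l x1).
    suff -> : (1 - x) * (a + b * ((1 - y) / (1 - x))) = a * (1 - x) + b * (1 - y) by [].
    by field; rewrite gt_eqF.
  have ha : - `|a| <= a * (1 - x).
    apply: (@le_trans _ _ (- `|a * (1 - x)|)); last by rewrite lerNl ler_normr lexx orbT.
    rewrite normrM (gtr0_norm x1) lerN2; apply: ler_piMr => //; lra.
  have hb : - `|b| <= b * (1 - y).
    apply: (@le_trans _ _ (- `|b * (1 - y)|)); last by rewrite lerNl ler_normr lexx orbT.
    rewrite normrM (@gtr0_norm _ (1 - y)) ?subr_gt0// lerN2.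
    by apply: ler_piMr => //; lra.
  by rewrite /binary_div; lra.
have [x [/andP[x0 xy] Fx]] :=
  binary_div_ivt f_convex f1 y01 delta_gt0 xn0 xny big.
have x01 : 0 < x < 1 by lra.
exists x; split=> //; apply/eqP; rewrite eq_le; apply/andP; split; last first.
  by apply: g_ub => //; [lra|rewrite Fx].
apply: g_least => // t /andP[xt t1] Ft; rewrite leNgt; apply/negP => yt.
have tx : 0 < t - x by lra.
pose l := (y - x) / (t - x).
have l0 : 0 <= l by rewrite divr_ge0//; lra.
have l1 : l < 1 by rewrite /l ltr_pdivrMr//; lra.
have : binary_div f x y <= l * binary_div f x t + (1 - l) * binary_div f x x.
  have yE : y = l * t + (1 - l) * x by rewrite /l; field; rewrite gt_eqF.
  have xE : x = l * x + (1 - l) * x by ring.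
  by rewrite {1}yE {1}xE; apply: div_conv => //; lra.
rewrite div_diag// mulr0 addr0 Fx.
have : l * binary_div f x t <= l * delta by rewrite ler_wpM2l.
have : l * delta < 1 * delta by rewrite ltr_pM2r.
by lra.
Qed.

(** This equivalence moves the distortion from the probability to the level. [g_phi_onto] makes the
    chosen preimage genuine, and [g_phi_lt] compares it with [p] at the level [y < 1]. *)
Lemma g_phi_le_inv (y p : R) : 0 < y < 1 -> 0 <= p <= 1 ->
  (g_phi phi delta p <= y) = (p <= g_phi_inv phi delta y).
Proof.
move=> y01 p01; have [x [x01 gx]] := g_phi_onto y01.
have /= : [set x : R | 0 <= x <= 1 /\ g_phi phi delta x = y] (g_phi_inv phi delta y).
  rewrite /g_phi_inv; apply: xgetPex; exists x; split=> //; lra.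
move: (g_phi_inv phi delta y) => {gx x01}x [x01 gx].
have x_gt0 : 0 < x.
  rewrite lt_neqAle; have [-> _] := andP x01; rewrite andbT.
  by apply/eqP => x0; move: gx; rewrite -x0 g_phi0//; lra.
have x_lt1 : x < 1.
  rewrite lt_neqAle; have [_ ->] := andP x01; rewrite andbT.
  by apply/eqP => x1; move: gx; rewrite x1 g_phi1; lra.
apply/idP/idP => [gp|].
  rewrite leNgt; apply/negP => xp; have [p1|p1] := ltP p 1.
    have : y < g_phi phi delta p by apply: (@g_phi_lt x) => //; lra.
    by rewrite ltNge gp.
  by move: gp; rewrite (_ : p = 1) ?g_phi1; lra.
rewrite le_eqVlt => /predU1P[->|px]; first by rewrite gx.
have [p0|p0] := leP p 0; first by rewrite g_phi0//; lra.
rewrite leNgt; apply/negP => gp.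
have : y < g_phi phi delta x by apply: (@g_phi_lt p) => //; lra.
by rewrite gx ltxx.
Qed.

End fixed_delta.

(** Strict Jensen: [y / p] and [(1 - y) / (1 - p)] are distinct and have mean 1 under the weights
    [p] and [1 - p]. *)
Lemma binary_div_gt0 (p y : R) : 0 < p -> p < y -> y < 1 -> 0 < binary_div f p y.
Proof.
move=> p0 py y1; have [_ strict _] := hsup.
have a0 : 0 <= y / p by rewrite divr_ge0; lra.
have b0 : 0 <= (1 - y) / (1 - p) by rewrite divr_ge0; lra.
have ab : y / p != (1 - y) / (1 - p).
  rewrite gt_eqF// (@lt_trans _ _ 1)//.
    by rewrite ltr_pdivrMr; lra.
  by rewrite ltr_pdivlMr; lra.
have p01 : 0 < p < 1 by lra.
have := strict _ _ _ a0 b0 ab p01.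
have -> : p * (y / p) + (1 - p) * ((1 - y) / (1 - p)) = 1.
  by field; rewrite !gt_eqF//; lra.
rewrite phi_divE ?lte_fin//; last lra.
by case: hphi => _ _ -> _; rewrite lte_fin.
Qed.

(** The threshold is the divergence needed to reach [y] from [p]; by convexity from the diagonal,
    any [t > y] costs more. *)
Lemma g_phi_small (p y : R) : 0 <= p -> p < y -> y < 1 ->
  exists2 e0 : R, 0 < e0 & forall e, 0 < e -> e < e0 -> g_phi phi e p <= y.
Proof.
move=> + + y1; rewrite le_eqVlt => /predU1P[<- y0|p0 py].
  by exists 1 => // e _ _; rewrite g_phi0// ltW.
exists (binary_div f p y); first exact: binary_div_gt0.
have p01 : 0 < p < 1 by lra.
move=> e e0 eF; apply: g_phi_least => // t pt; rewrite phi_divE//; last lra.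
rewrite lee_fin => Ft; rewrite leNgt; apply/negP => yt.
have tp : 0 < t - p by lra.
pose l := (y - p) / (t - p).
have l0 : 0 < l by rewrite divr_gt0//; lra.
have l1 : l < 1 by rewrite /l ltr_pdivrMr//; lra.
have : binary_div f p y <= l * binary_div f p t + (1 - l) * binary_div f p p.
  have yE : y = l * t + (1 - l) * p by rewrite /l; field; rewrite gt_eqF.
  have pE : p = l * p + (1 - l) * p by ring.
  by rewrite {1}yE {1}pE; apply: div_conv => //; lra.
rewrite div_diag// mulr0 addr0.
have : l * binary_div f p t <= l * e by rewrite ler_pM2l.
have : l * e < 1 * e by rewrite ltr_pM2r.
by lra.
Qed.

End g_phi_finite.

(** * Comparison of integrals off a null set, without measurability *)

Section le_integral_off_null.
Local Open Scope ereal_scope.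
Context d (T : measurableType d) (R : realType).
Variable mu : {measure set T -> \bar R}.
Import HBNNSimple.

(** A simple function below [f], set to 0 on [N], keeps its integral and lies below [g]. *)
Lemma ge0_le_integral_off_null (f g : T -> \bar R) (N : set T) :
  measurable N -> mu N = 0 -> (forall x, 0 <= f x) -> (forall x, 0 <= g x) ->
  (forall x, ~ N x -> f x <= g x) -> \int[mu]_x f x <= \int[mu]_x g x.
Proof.
move=> mN N0 f0 g0 fg; rewrite !ge0_integralTE//.
apply: ge_ereal_sup => _ [h hf <-].
have mNC := measurableC mN.
apply: ereal_sup_ubound; exists (proj_nnsfun h mNC).
  move=> x /=; rewrite mindicE; have [xN|xN] := pselect (N x).
    by rewrite memNset ?mulr0//=; apply.
  by rewrite mem_set// mulr1; exact: le_trans (hf x) (fg _ xN).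
rewrite -!integralT_nnsfun (ge0_negligible_integral mN)//; last 2 first.
- exact/measurable_EFinP.
- by move=> x _; rewrite lee_fin.
rewrite [RHS](ge0_negligible_integral mN)//; last 2 first.
- exact/measurable_EFinP.
- by move=> x _; rewrite lee_fin.
apply: eq_integral => x; rewrite inE => -[_ xN] /=.
by rewrite mindicE mem_set// mulr1.
Qed.

(* [+oo - +oo = -oo] in [\bar R], so the difference of the integrals of the
   positive and negative parts is monotone without integrability; [phi] is
   arbitrary on negative reals, so [phi \o density] need not be measurable. *)
Lemma le_integral_off_null (f g : T -> \bar R) (N : set T) :
  measurable N -> mu N = 0 ->
  (forall x, ~ N x -> f x <= g x) -> \int[mu]_x f x <= \int[mu]_x g x.
Proof.
move=> mN N0 fg; rewrite integralE [leRHS]integralE leeB//.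
- apply: (ge0_le_integral_off_null mN) => // x xN.
  by rewrite !funeposE ge_max !le_max lexx fg// orbT.
- apply: (ge0_le_integral_off_null mN) => // x xN.
  by rewrite !funenegE ge_max !le_max lexx leeN2 fg// orbT.
Qed.

End le_integral_off_null.

(** * Real-valued densities and integrals of piecewise affine functions of them *)

Section density.
Local Open Scope ereal_scope.
Context d (T : measurableType d) (R : realType).
Variables P Q : probability T R.
Hypothesis QP : Q `<< P.

Definition density (x : T) : R :=
  fine (Radon_Nikodym (charge_of_finite_measure Q) P x).

Let densityE : EFin \o density = Radon_Nikodym (charge_of_finite_measure Q) P.
Proof. by apply/funext => x /=; rewrite fineK// Radon_Nikodym_fin_num. Qed.

Lemma density_integrable : P.-integrable setT (EFin \o density).
Proof. by rewrite densityE; exact: Radon_Nikodym_integrable. Qed.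

Lemma density_measurable : measurable_fun setT density.
Proof. exact/measurable_EFinP/measurable_int/density_integrable. Qed.

Lemma density_integral (A : set T) : measurable A ->
  \int[P]_(x in A) (density x)%:E = Q A.
Proof.
move=> mA; rewrite (eq_integral (Radon_Nikodym (charge_of_finite_measure Q) P)).
  by rewrite -Radon_Nikodym_integral.
by move=> x _; rewrite -densityE.
Qed.

(** The derivative of a charge may be negative on a null set; it agrees almost everywhere with the
    nonnegative derivative of the measure. *)
Lemma density_ge0 : exists N : set T,
  [/\ measurable N, P N = 0 & forall x, ~ N x -> (0 <= density x)%R].
Proof.
have [N [mN N0 hN]] := ae_eq_Radon_Nikodym_SigmaFinite QP (@measurableT _ T).
exists N; split=> // x xN; apply: fine_ge0.
have <- : Radon_Nikodym_SigmaFinite.f Q P x =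
    Radon_Nikodym (charge_of_finite_measure Q) P x.
  by apply: contrapT => h; apply: xN; apply: hN => /= /(_ I).
exact: Radon_Nikodym_SigmaFinite.f_ge0.
Qed.

Let integral_affine (A : set T) (c s : R) : measurable A ->
  \int[P]_(x in A) (c + s * density x)%:E = (c * fine (P A) + s * fine (Q A))%:E.
Proof.
move=> mA; have fi : P.-integrable A (EFin \o density).
  by apply: integrableS density_integrable.
under eq_integral do rewrite EFinD EFinM.
rewrite integralD//; last 2 first.
- exact: finite_measure_integrable_cst.
- exact: integrableZl.
rewrite integral_cst// integralZl// density_integral//.
by rewrite EFinD !EFinM !fineK// fin_num_measure.
Qed.

(** With suitable coefficients this one formula yields the integrated supporting lines, [Q A],
    multiples of [P A], and the divergence of a two-piece density. *)
Lemma integral_two_piece (A : set T) (c1 s1 c2 s2 : R) : measurable A ->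
  \int[P]_x (if x \in A then c1 + s1 * density x else c2 + s2 * density x)%:E =
  (c1 * fine (P A) + s1 * fine (Q A) +
   (c2 * (1 - fine (P A)) + s2 * (1 - fine (Q A))))%:E.
Proof.
move=> mA; have mAC := measurableC mA.
have mfun c s D : measurable_fun D (fun x => (c + s * density x)%R).
  apply: measurable_funTS; apply: measurable_funD => //.
  by apply: measurable_funM => //; exact: density_measurable.
rewrite -(setUv A) integral_setU//; last 2 first.
- rewrite setUv; apply/measurable_EFinP; apply: measurable_fun_ifT => //.
  apply: (measurable_fun_bool true); rewrite setTI (_ : _ @^-1` _ = A)//.
  by apply/seteqP; split=> x /=; [exact: set_mem|exact: mem_set].
- by apply/disj_setPCl.
rewrite (_ : \int[P]_(x in A) _ = \int[P]_(x in A) (c1 + s1 * density x)%:E); last first.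
  by apply: eq_integral => x ->.
rewrite (_ : \int[P]_(x in ~` A) _ = \int[P]_(x in ~` A) (c2 + s2 * density x)%:E); last first.
  by apply: eq_integral => x; rewrite in_setC => /negbTE ->.
by rewrite !integral_affine// !probability_setC// !fineB ?fin_num_measure.
Qed.

End density.

(** * Probabilities with density constant on an event and on its complement *)

Section two_piece_probability.
Local Open Scope ereal_scope.
Context d (T : measurableType d) (R : realType).
Variables (P : probability T R) (A : set T) (mA : measurable A).
Variables (a b : {nonneg R}).
Hypothesis ab1 : (a%:num * fine (P A) + b%:num * (1 - fine (P A)) = 1)%R.

Definition two_piece_measure : set T -> \bar R :=
  measure_add (mscale a (mrestr P mA)) (mscale b (mrestr P (measurableC mA))).

HB.instance Definition _ := Measure.on two_piece_measure.

Lemma two_piece_measureE (B : set T) :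
  two_piece_measure B = a%:num%:E * P (B `&` A) + b%:num%:E * P (B `&` ~` A).
Proof. by rewrite /two_piece_measure measure_addE. Qed.

Let two_piece_setT : two_piece_measure setT = 1.
Proof.
rewrite two_piece_measureE !setTI probability_setC//.
rewrite -(@fineK _ (P A)) ?fin_num_measure//.
by rewrite -EFinB -!EFinM -EFinD ab1.
Qed.

HB.instance Definition _ := Measure_isProbability.Build _ _ _
  two_piece_measure two_piece_setT.

Definition two_piece_probability : probability T R := two_piece_measure.

End two_piece_probability.

(** * The largest probability of an event over the divergence ball *)

Section phi_divergence_ball.
Context d (T : measurableType d) (R : realType).
Variables (P : probability T R) (phi : R -> \bar R) (delta : R).
Hypothesis hphi : admissible_phi phi.
Hypothesis delta_gt0 : 0 < delta.

Lemma probability_fine01 (Q : probability T R) (A : set T) :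
  measurable A -> 0 <= fine (Q A) <= 1.
Proof.
move=> mA; rewrite fine_ge0//= -lee_fin fineK ?fin_num_measure//.
exact: probability_le1.
Qed.

Lemma phi_div_ge (Q : probability T R) (A : set T) (c1 s1 c2 s2 : R) :
  Q `<< P -> measurable A ->
  (forall y : R, 0 <= y -> ((c1 + s1 * y)%:E <= phi y)%E) ->
  (forall y : R, 0 <= y -> ((c2 + s2 * y)%:E <= phi y)%E) ->
  ((c1 * fine (P A) + s1 * fine (Q A) +
   (c2 * (1 - fine (P A)) + s2 * (1 - fine (Q A))))%:E <= phi_div phi P Q)%E.
Proof.
move=> QP mA h1 h2; have [N [mN N0 f0]] := density_ge0 QP.
rewrite -integral_two_piece//; apply: (le_integral_off_null mN N0) => x /f0 fx.
by case: ifP => _; [exact: h1|exact: h2].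
Qed.

Lemma density_preimage_measurable (Q : probability T R) (I : set R) :
  Q `<< P -> measurable I -> measurable (density P Q @^-1` I).
Proof.
by move=> QP mI; rewrite -[_ @^-1` _]setTI; exact: density_measurable.
Qed.

(** Where [phi] of the density is infinite, the affine minorant can be raised by any constant [n];
    if that event had positive probability, the divergence would exceed [delta]. *)
Lemma phi_infinite_null (Q : probability T R) (I : set R) :
  Pphi phi P delta Q -> measurable I ->
  (forall u : R, I u -> 0 <= u -> phi u = +oo%E) ->
  P (density P Q @^-1` I) = 0%E.
Proof.
move=> [QP Qd] mI hoo; have [a [b ab]] := phi_affine_lower_bound hphi.
have [N [mN N0 f0]] := density_ge0 QP.
have mA := density_preimage_measurable QP mI; set A := _ @^-1` _ in mA *.
suff : fine (P A) <= 0.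
  move=> pA; have /andP[pA0 _] := probability_fine01 P mA.
  apply/eqP; rewrite -[X in X == _]fineK ?fin_num_measure//.
  by rewrite eqe eq_le pA pA0.
rewrite leNgt; apply/negP => pA.
(* This [n] makes the lower bound equal to [delta + 1]. *)
pose n := (delta - a - b + 1) / fine (P A).
suff : ((a + b + n * fine (P A))%:E <= delta%:E)%E.
  by rewrite lee_fin /n divfK ?gt_eqF//; lra.
apply: le_trans Qd.
rewrite (_ : a + b + n * fine (P A) = (a + n) * fine (P A) + b * fine (Q A) +
   (a * (1 - fine (P A)) + b * (1 - fine (Q A)))); last by ring.
rewrite -integral_two_piece//; apply: (le_integral_off_null mN N0) => x /f0 fx.
case: ifPn => [/set_mem mx|_]; last exact: ab.
by rewrite -/(density P Q x) hoo// leey.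
Qed.

(** If [phi] were infinite beyond [m], the density would be at most [m] almost everywhere, and [Q A]
    at most [m] times [P A]. This and its mirror image below provide the finite points required by
    [phi_support]. *)
Lemma phi_finite_above (Q : probability T R) (A : set T) (m : R) :
  Pphi phi P delta Q -> measurable A -> 0 <= m -> m * fine (P A) < fine (Q A) ->
  exists2 u : R, m < u & phi u \is a fin_num.
Proof.
move=> PQ mA m0 mt; apply: contrapT => h; move: mt; rewrite ltNge => /negP; apply.
have [QP _] := PQ; have mI : measurable (`]m, +oo[%classic : set R) by [].
have N0 : P (density P Q @^-1` `]m, +oo[%classic) = 0%E.
  apply: phi_infinite_null => // u; rewrite /= in_itv/= andbT => mu u0.
  apply: contrapT => /eqP uoo; apply: h; exists u => //.
  by apply: (phi_fin_ltoo hphi) => //; rewrite lt_neqAle uoo leey.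
have mN := density_preimage_measurable QP mI.
rewrite -lee_fin.
have := @integral_two_piece _ _ _ P Q QP A 0 1 0 0 mA.
rewrite (_ : 0 * _ + _ + _ = fine (Q A)); last by ring.
move=> <-.
have := @integral_two_piece _ _ _ P Q QP A m 0 0 0 mA.
rewrite (_ : m * _ + _ + _ = m * fine (P A)); last by ring.
move=> <-.
apply: (le_integral_off_null mN N0) => x /= /negP.
rewrite in_itv/= andbT -leNgt => fx; rewrite lee_fin.
by case: ifP => _; lra.
Qed.

Lemma phi_finite_below (Q : probability T R) (A : set T) (m : R) :
  Pphi phi P delta Q -> measurable A -> fine (Q A) < m * fine (P A) ->
  exists u : R, [/\ 0 <= u, u < m & phi u \is a fin_num].
Proof.
move=> PQ mA mt; apply: contrapT => h; move: mt; rewrite ltNge => /negP; apply.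
have [QP _] := PQ; have mI : measurable (`]-oo, m[%classic : set R) by [].
have N0 : P (density P Q @^-1` `]-oo, m[%classic) = 0%E.
  apply: phi_infinite_null => // u; rewrite /= in_itv/= => mu u0.
  apply: contrapT => /eqP uoo; apply: h; exists u; split=> //.
  by apply: (phi_fin_ltoo hphi) => //; rewrite lt_neqAle uoo leey.
have mN := density_preimage_measurable QP mI.
rewrite -lee_fin.
have := @integral_two_piece _ _ _ P Q QP A 0 1 0 0 mA.
rewrite (_ : 0 * _ + _ + _ = fine (Q A)); last by ring.
move=> <-.
have := @integral_two_piece _ _ _ P Q QP A m 0 0 0 mA.
rewrite (_ : m * _ + _ + _ = m * fine (P A)); last by ring.
move=> <-.
apply: (le_integral_off_null mN N0) => x /= /negP.
rewrite in_itv/= -leNgt => fx; rewrite lee_fin.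
by case: ifP => _; lra.
Qed.

(* For [p < t' < t] the points [t' / p] and [(1 - t') / (1 - p)] are interior to
   the domain of [phi], even when [t / p] is an endpoint at which [phi] has no
   supporting line. *)
Lemma Pphi_le_g_phi (Q : probability T R) (A : set T) :
  Pphi phi P delta Q -> measurable A ->
  fine (Q A) <= g_phi phi delta (fine (P A)).
Proof.
move=> PQ mA; have [QP Qd] := PQ.
have /andP[p0 p1] := probability_fine01 P mA.
have /andP[t0 t1] := probability_fine01 Q mA.
have mAC := measurableC mA.
have pC : fine (P (~` A)) = 1 - fine (P A).
  by rewrite probability_setC// fineB// fin_num_measure.
have tC : fine (Q (~` A)) = 1 - fine (Q A).
  by rewrite probability_setC// fineB// fin_num_measure.
have := @phi_div_ge Q A; have := phi_finite_below PQ mAC.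
have := phi_finite_above PQ mA; rewrite pC tC.
(* Absolute continuity settles [p = 0], where [g_phi] vanishes. *)
have Q0 : fine (P A) = 0 -> fine (Q A) = 0.
  move=> pA0; have PA0 : P A = 0%E by rewrite -[LHS]fineK ?fin_num_measure// pA0.
  by move/null_content_dominatesP : QP => /(_ A mA PA0) ->.
move: Q0 p0 p1 t0 t1; move: (fine (P A)) (fine (Q A)) => p t Q0 p0 p1 t0 t1.
move=> above below div_ge.
have [p_le0|p_gt0] := leP p 0.
  by rewrite Q0 ?g_phi0//; apply/eqP; rewrite eq_le p_le0 p0.
have [p_ge1|p_lt1] := leP 1 p.
  by rewrite (_ : p = 1) ?g_phi1//; apply/eqP; rewrite eq_le p_ge1 p1.
have p01 : 0 < p < 1 by rewrite p_gt0 p_lt1.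
have [tp|pt] := leP t p; first exact: le_trans tp (g_phi_ge hphi delta_gt0 p01).
rewrite leNgt; apply/negP => gt.
have pg := g_phi_ge hphi delta_gt0 p01.
pose t' := (g_phi phi delta p + t) / 2.
have gt' : g_phi phi delta p < t' by rewrite /t'; lra.
have t't : t' < t by rewrite /t'; lra.
have q0 : 0 < 1 - p by lra.
pose m1 := t' / p; pose m2 := (1 - t') / (1 - p).
have pm1 : m1 * p = t' by rewrite /m1 divfK ?gt_eqF.
have pm2 : m2 * (1 - p) = 1 - t' by rewrite /m2 divfK ?gt_eqF.
have m1_gt1 : 1 < m1 by rewrite /m1 ltr_pdivlMr//; lra.
have m2_lt1 : m2 < 1 by rewrite /m2 ltr_pdivrMr//; lra.
have m1_ge0 : 0 <= m1 by lra.
have [||u m1u uf] := above m1; [by []|by rewrite pm1|].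
have [|v [v0 vm2 vf]] := below m2; first by rewrite pm2; lra.
have vm1 : v < m1 by lra.
have m2u : m2 < u by lra.
have [f1 [s1 h1]] := phi_support hphi v0 vm1 m1u vf uf.
have [f2 [s2 h2]] := phi_support hphi v0 vm2 m2u vf uf.
have m2_ge0 : 0 <= m2 by lra.
(* Supporting slopes increase from [m2] to [m1]. The lines touch at [t'] while [Q A] is [t], and the
   resulting extra term [(s1 - s2) * (t - t')] is nonnegative. *)
have s21 : s2 <= s1.
  have := h1 _ m2_ge0; have := h2 _ m1_ge0.
  rewrite -[X in (_ <= X)%E -> _]fineK// -[X in _ -> (_ <= X)%E -> _]fineK//.
  rewrite !lee_fin => k1 k2.
  have : (s2 - s1) * (m1 - m2) <= 0 by lra.
  by rewrite pmulr_lle0 ?subr_le0//; lra.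
have : ((p * fine (phi m1) + (1 - p) * fine (phi m2))%:E <= delta%:E)%E.
  apply: le_trans Qd.
  apply: le_trans (div_ge (fine (phi m1) - s1 * m1) s1
    (fine (phi m2) - s2 * m2) s2 QP mA _ _); last 2 first.
  - by move=> y y0; apply: le_trans (h1 _ y0); rewrite lee_fin; lra.
  - by move=> y y0; apply: le_trans (h2 _ y0); rewrite lee_fin; lra.
  rewrite lee_fin.
  have : 0 <= (s1 - s2) * (t - t') by rewrite mulr_ge0; lra.
  have : s1 * (m1 * p) = s1 * t' by rewrite pm1.
  have : s2 * (m2 * (1 - p)) = s2 * (1 - t') by rewrite pm2.
  by lra.
rewrite EFinD !EFinM !fineK// => Et'.
have : t' <= g_phi phi delta p by apply: g_phi_ub => //; lra.
by rewrite leNgt gt'.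
Qed.

Lemma two_piece_Pphi (A : set T) (mA : measurable A) (a b : {nonneg R})
    (ab1 : a%:num * fine (P A) + b%:num * (1 - fine (P A)) = 1) :
  phi a%:num \is a fin_num -> phi b%:num \is a fin_num ->
  fine (phi a%:num) * fine (P A) + fine (phi b%:num) * (1 - fine (P A)) <= delta ->
  Pphi phi P delta (two_piece_probability mA ab1).
Proof.
move=> af bf le; set Q := two_piece_probability mA ab1.
have QE B : Q B = (a%:num%:E * P (B `&` A) + b%:num%:E * P (B `&` ~` A))%E.
  exact: two_piece_measureE.
have mAC := measurableC mA.
have QP : Q `<< P.
  apply/null_content_dominatesP => B mB B0; rewrite QE.
  have z C : measurable C -> P (B `&` C) = 0%E.
    move=> mC; apply/eqP; rewrite eq_le measure_ge0 andbT -B0.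
    by apply: le_measure => //; rewrite ?inE//; exact: measurableI.
  by rewrite !z// !mule0 adde0.
(* The density is known only through its integrals, so its constant values are recovered almost
   everywhere on each piece. *)
have ae (D : set T) (c : R) : measurable D ->
    (forall E, E `<=` D -> measurable E -> Q E = (c%:E * P E)%E) ->
    ae_eq P D (EFin \o density P Q) (cst c%:E).
  move=> mD h; apply: integral_ae_eq => //.
    by apply: integrableS (density_integrable QP).
  by move=> E ED mE; rewrite density_integral// integral_cst// h.
have [N1 [mN1 N10 hN1]] : ae_eq P A (EFin \o density P Q) (cst a%:num%:E).
  apply: ae => // E EA mE; rewrite QE (setIidl EA) (_ : _ `&` ~` _ = set0).
    by rewrite measure0 mule0 adde0.
  by apply/seteqP; split=> // x [/EA].
have [N2 [mN2 N20 hN2]] : ae_eq P (~` A) (EFin \o density P Q) (cst b%:num%:E).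
  apply: ae => // E EA mE; rewrite QE (setIidl EA) (_ : _ `&` A = set0).
    by rewrite measure0 mule0 add0e.
  by apply/seteqP; split=> // x [/EA].
have mN : measurable (N1 `|` N2) by exact: measurableU.
have N0 : P (N1 `|` N2) = 0%E by rewrite measureU0.
split=> //; apply: (@le_trans _ _ (fine (phi a%:num) * fine (P A) +
    fine (phi b%:num) * (1 - fine (P A)))%:E); last by rewrite lee_fin.
have := @integral_two_piece _ _ _ P Q QP A (fine (phi a%:num)) 0
  (fine (phi b%:num)) 0 mA.
rewrite !mul0r !addr0 => <-.
apply: (le_integral_off_null mN N0) => x /not_orP[xN1 xN2].
rewrite !mul0r !addr0 -/(density P Q x).
case: ifPn => [/set_mem Ax|/negP Ax].
  suff -> : density P Q x = a%:num by rewrite fineK.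
  apply: contrapT => h; apply: xN1; apply: hN1 => /= /(_ Ax) [].
  exact: h.
suff -> : density P Q x = b%:num by rewrite fineK.
apply: contrapT => h; apply: xN2; apply: hN2 => /= hx; apply: h.
by apply/EFin_inj/hx => /mem_set.
Qed.

(** Pick an admissible [t > c] and give [Q] the density [t / p] on [A] and [(1 - t) / (1 - p)] off
    it, with [p] the probability of [A], so that [Q A] is [t]. *)
Lemma g_phi_attained (A : set T) (c : R) : measurable A -> 0 <= c ->
  c < g_phi phi delta (fine (P A)) ->
  exists2 Q, Pphi phi P delta Q & c < fine (Q A).
Proof.
move=> mA c0 cg; have /andP[p0 p1] := probability_fine01 P mA.
have [p_le0|p_gt0] := leP (fine (P A)) 0.
  by move: cg; rewrite g_phi0//; lra.
have QA (a b : {nonneg R}) ab1 :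
    fine (@two_piece_probability _ _ _ P A mA a b ab1 A) = a%:num * fine (P A).
  rewrite /= two_piece_measureE setIid setICr measure0 mule0 adde0.
  by rewrite fineM// fin_num_measure.
have [p_ge1|p_lt1] := leP 1 (fine (P A)).
  have pE : fine (P A) = 1 by apply/eqP; rewrite eq_le p_ge1 p1.
  (* When [A] has full probability, the constant density 1 suffices. *)
  have ab1 : 1%:nng%:num * fine (P A) + 1%:nng%:num * (1 - fine (P A)) = 1 :> R.
    by rewrite /=; ring.
  exists (two_piece_probability mA ab1).
    apply: two_piece_Pphi; rewrite /=; [exact: phi1_fin..|].
    by case: hphi => _ _ -> _ /=; rewrite !mul0r addr0 ltW.
  by rewrite QA /= mul1r pE; move: cg; rewrite pE g_phi1.
have p01 : 0 < fine (P A) < 1 by rewrite p_gt0.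
have [t [/andP[pt t1] Et ct]] := g_phi_approx hphi delta_gt0 p01 cg.
have q_gt0 : 0 < 1 - fine (P A) by rewrite subr_gt0.
have a0 : 0 <= t / fine (P A) by rewrite divr_ge0//; lra.
have b0 : 0 <= (1 - t) / (1 - fine (P A)) by rewrite divr_ge0//; lra.
have ab1 : (NngNum a0)%:num * fine (P A) + (NngNum b0)%:num * (1 - fine (P A)) = 1.
  by rewrite /= !divfK ?gt_eqF//; ring.
(* Both weights are positive and [phi] is never [-oo], so one infinite value would make the sum
   exceed [delta]. *)
have fin2 : phi (t / fine (P A)) \is a fin_num /\
    phi ((1 - t) / (1 - fine (P A))) \is a fin_num.
  have [pN _ _ _] := hphi; move: (pN _ a0) (pN _ b0) Et.
  case: (phi (t / _)) => [r| |] //; case: (phi ((1 - t) / _)) => [r'| |] //= _ _.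
  - by rewrite gt0_muley ?lte_fin// addey// -?EFinM// leye_eq.
  - by rewrite gt0_muley ?lte_fin// addye// -?EFinM// leye_eq.
  - by rewrite !gt0_muley ?lte_fin// addye// leye_eq.
have [af bf] := fin2.
exists (two_piece_probability mA ab1).
  apply: two_piece_Pphi => //=.
  rewrite -lee_fin EFinD [(_ * fine (P A))%R]mulrC [(_ * (1 - _))%R]mulrC.
  by rewrite !EFinM !(@fineK _ (phi _)).
by rewrite QA /= divfK ?gt_eqF.
Qed.

End phi_divergence_ball.

(** * From tail events to Lambda-value-at-risk *)

Section lambda_value_at_risk.
Context d (T : measurableType d) (R : realType).

Lemma le_of_lt_real (v s : \bar R) :
  (forall x : R, (s < x%:E)%E -> (v <= x%:E)%E) -> (v <= s)%E.
Proof.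
case: s => [r h|_|h]; last 2 first.
- exact: leey.
- case: v h => [r|/(_ 0 (ltNyr _))|] // /(_ (r - 1) (ltNyr _)).
  by rewrite lee_fin lerBrDr gerDl ler10.
apply/lee_addgt0Pr => e e0; rewrite -EFinD; apply: h.
by rewrite lte_fin ltrDl.
Qed.

Variable X : T -> R.
Hypothesis mX : measurable_fun setT X.

Lemma measurable_tail (x : R) : measurable [set om | x < X om].
Proof.
rewrite (_ : [set om | _] = setT `&` X @^-1` `]x, +oo[%classic).
  exact: mX.
by rewrite setTI; apply/seteqP; split=> om /=; rewrite in_itv/= andbT.
Qed.

Lemma tail_antitone (Q : probability T R) (x y : R) : x <= y ->
  fine (Q [set om | y < X om]) <= fine (Q [set om | x < X om]).
Proof.
move=> xy; rewrite fine_le ?fin_num_measure//; try exact: measurable_tail.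
apply: le_measure; rewrite ?inE; try exact: measurable_tail.
by move=> om /=; exact: le_lt_trans.
Qed.

Lemma LVaR_le (w : set T -> \bar R) (L : R -> R) (x : R) :
  (w [set om | (x < X om)%R] <= (L x)%:E)%E -> (LVaR w L X <= x%:E)%E.
Proof. by move=> wL; apply: ereal_inf_lbound; exists x. Qed.

(** The strict inequality at [x] persists at every [y < x], where [L] is smaller and the tail
    larger, so no such [y] enters the infimum. *)
Lemma LVaR_ge (Q : probability T R) (L : R -> R) (x : R) :
  {homo L : x y / x <= y} -> L x < fine (Q [set om | x < X om]) ->
  (x%:E <= LVaR Q L X)%E.
Proof.
move=> Lhomo Lx; apply: le_ereal_inf_tmp => _ [y /= wy <-].
rewrite lee_fin leNgt; apply/negP => yx.
move: wy; rewrite -[X in (X <= _)%E]fineK; last first.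
  exact/fin_num_measure/measurable_tail.
rewrite lee_fin leNgt => /negP; apply.
apply: le_lt_trans (Lhomo _ _ (ltW yx)) _; apply: lt_le_trans Lx _.
by apply: tail_antitone; exact: ltW.
Qed.

Variables (P : probability T R) (phi : R -> \bar R).
Hypothesis hphi : admissible_phi phi.

Lemma sup_LVaR_Pphi (delta : R) (L : R -> R) : 0 < delta ->
  {homo L : x y / x <= y} -> (forall x, 0 <= L x) ->
  ereal_sup [set LVaR Q L X | Q in Pphi phi P delta] =
  LVaR (distort (g_phi phi delta) P) L X.
Proof.
move=> d0 Lhomo L0; apply/eqP; rewrite eq_le; apply/andP; split.
  apply: ge_ereal_sup => _ [Q PQ <-].
  apply: le_ereal_inf => _ [x /= gx <-]; exists x => //=.
  move: gx; rewrite /distort lee_fin => gx.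
  rewrite -[leLHS]fineK ?fin_num_measure//; last exact: measurable_tail.
  rewrite lee_fin; apply: le_trans gx; apply: Pphi_le_g_phi => //.
  exact: measurable_tail.
(* If a real [x] above the supremum violated the distorted constraint, some [Q] in the ball would
   have a tail above [L x], and [LVaR_ge] would put [x] below the supremum. *)
apply: le_of_lt_real => x; rewrite ltNge => /negP Sx; apply: LVaR_le.
rewrite /distort lee_fin leNgt; apply/negP => /(g_phi_attained hphi d0 _ (L0 x)).
move=> /(_ (measurable_tail x))[Q PQ LQ]; apply: Sx.
apply: le_trans (LVaR_ge Lhomo LQ) _.
by apply: ereal_sup_ubound; exists Q.
Qed.

Hypothesis hsup : strict_superlinear_phi phi.

Lemma LVaR_distort_inv (delta : R) (L : R -> R) : 0 < delta ->
  (forall x, 0 < L x < 1) ->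
  LVaR (distort (g_phi phi delta) P) L X =
  LVaR P (fun x => g_phi_inv phi delta (L x)) X.
Proof.
move=> d0 L01; rewrite /LVaR; congr (ereal_inf (_ @` _)).
apply/funext => x /=; apply/propext.
rewrite /distort -[X in _ <-> is_true (X <= _)%E]fineK; last first.
  exact/fin_num_measure/measurable_tail.
by rewrite !lee_fin (g_phi_le_inv hphi hsup d0)//; exact/probability_fine01/measurable_tail.
Qed.

Lemma sup_LVaR_Pphi_cvg (L : R -> R) : H_I L ->
  ereal_sup [set LVaR Q L X | Q in Pphi phi P e] @[e --> (0:R)^'+] --> LVaRp P L X.
Proof.
move=> [Lhomo L01]; set S := fun e => _.
(* [S] increases with the radius [e], so its right limit at 0 is its infimum. *)
have Sinf : ereal_inf (S @` `]0, +oo[%classic) = LVaRp P L X.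
  apply/eqP; rewrite eq_le; apply/andP; split.
    apply: le_of_lt_real => x Lx.
    have pL : fine (P [set om | x < X om]) < L x.
      rewrite ltNge; apply/negP => pL; move: Lx; rewrite ltNge => /negP; apply.
      apply: ereal_sup_ubound; exists x => //=.
      rewrite -[leRHS]fineK ?lee_fin//.
      exact/fin_num_measure/measurable_tail.
    have /andP[p0 _] := probability_fine01 P (measurable_tail x).
    have /andP[_ Lx1] := L01 x.
    have [e0 e00 he] := g_phi_small hphi hsup p0 pL Lx1.
    have e2 : 0 < e0 / 2 by lra.
    apply: (@le_trans _ _ (S (e0 / 2))).
      by apply: ereal_inf_lbound; exists (e0 / 2) => //=; rewrite in_itv/= andbT.
    rewrite /S sup_LVaR_Pphi//; last by move=> z; case/andP: (L01 z) => /ltW.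
    by apply: LVaR_le; rewrite lee_fin he//; lra.
  apply: ge_ereal_sup => _ [x /= Lp <-].
  apply: le_ereal_inf_tmp => _ [e /= + <-]; rewrite in_itv/= andbT => e0.
  have /andP[Lx0 Lx1] := L01 x.
  have mt := measurable_tail x.
  move: Lp; rewrite -[leRHS]fineK ?fin_num_measure// lee_fin => Lp.
  have /andP[p0 p1] := probability_fine01 P mt.
  (* The weak inequality in [LVaRp] becomes strict for each [e > 0]: by [g_phi_gt_id] below 1, and
     by [L x < 1] at a tail of probability 1. *)
  have Lg : L x < g_phi phi e (fine (P [set om | x < X om])).
    have [p_ge1|p_lt1] := leP 1 (fine (P [set om | x < X om])).
      by rewrite (_ : fine _ = 1) ?g_phi1//; apply/eqP; rewrite eq_le p_ge1 p1.
    apply: (le_lt_trans Lp); apply: g_phi_gt_id => //.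
    by rewrite (lt_le_trans Lx0 Lp).
  have [Q PQ LQ] := g_phi_attained hphi e0 mt (ltW Lx0) Lg.
  apply: le_trans (LVaR_ge Lhomo LQ) _.
  by apply: ereal_sup_ubound; exists Q.
rewrite -Sinf; apply: (@nondecreasing_at_right_cvge _ S 0 (BInfty _ false)) => //.
move=> e e' _ _ ee'; apply: le_ereal_sup => _ [Q [QP Qe] <-]; exists Q => //.
by split=> //; apply: le_trans Qe _; rewrite lee_fin.
Qed.

Lemma LVaR_g_phi_inv_cvg (L : R -> R) : H_I L ->
  LVaR P (fun x => g_phi_inv phi e (L x)) X @[e --> (0:R)^'+] --> LVaRp P L X.
Proof.
move=> hL; have [Lhomo L01] := hL; apply: cvg_trans (sup_LVaR_Pphi_cvg hL).
apply: near_eq_cvg; near=> e.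
have e0 : 0 < e by near: e; exact: nbhs_right_gt.
rewrite -LVaR_distort_inv// sup_LVaR_Pphi// => x.
by case/andP: (L01 x) => /ltW.
Unshelve. all: by end_near. Qed.

End lambda_value_at_risk.

Theorem mainTheorem6 (d : measure_display) (T : measurableType d) (R : realType)
    (XX : set (T -> R)) (hXX : rv_class XX)
    (delta : R) (hdelta : 0 < delta)
    (P : probability T R) (phi : R -> \bar R) (hphi : admissible_phi phi)
    (L : R -> R) (hL : H_I L) (alpha : R) (halpha : 0 < alpha < 1) :
  (* first part *)
  (forall X, XX X ->
     ereal_sup [set LVaR Q L X | Q in Pphi phi P delta]
       = LVaR (distort (g_phi phi delta) P) L X) /\
  (forall X, XX X ->
     ereal_sup [set VaR Q alpha X | Q in Pphi phi P delta]
       = VaR (distort (g_phi phi delta) P) alpha X) /\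
  (* second part, under strict convexity and superlinearity *)
  (strict_superlinear_phi phi ->
     (forall X, XX X ->
        ereal_sup [set LVaR Q L X | Q in Pphi phi P delta]
          = LVaR P (fun x => g_phi_inv phi delta (L x)) X) /\
     (forall X, XX X ->
        ereal_sup [set VaR Q alpha X | Q in Pphi phi P delta]
          = VaR P (g_phi_inv phi delta alpha) X) /\
     (forall X, XX X ->
        (ereal_sup [set LVaR Q L X | Q in Pphi phi P e] @[e --> (0:R)^'+]
           --> LVaRp P L X) /\
        (LVaR P (fun x => g_phi_inv phi e (L x)) X @[e --> (0:R)^'+]
           --> LVaRp P L X))).
Proof.
have [XXm _] := hXX; have [Lhomo L01] := hL; have /andP[a0 a1] := halpha.
have L0 x : 0 <= L x by case/andP: (L01 x) => /ltW.
have chomo : {homo (fun _ : R => alpha) : x y / x <= y} by [].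
split; [|split].
- by move=> X /XXm mX; exact: sup_LVaR_Pphi.
- by move=> X /XXm mX; apply: sup_LVaR_Pphi => // _; exact: ltW.
move=> hsup; split; [|split].
- by move=> X /XXm mX; rewrite sup_LVaR_Pphi// LVaR_distort_inv.
- move=> X /XXm mX; rewrite [LHS]sup_LVaR_Pphi//; last by move=> _; exact: ltW.
  by rewrite LVaR_distort_inv.
- move=> X /XXm mX; split; first exact: sup_LVaR_Pphi_cvg.
  exact: LVaR_g_phi_inv_cvg.
Qed.
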